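(* Let $H$ be a convex Hamiltonian and assume $H_1=\cdots=H_m=H$. Then $\mathcal A=\mathcal A^*$. Moreover, all critical solutions of the system are of the form $\mathbf u=u\,\mathbb 1$, where $u$ is a critical solution of $H$.
   Context: Let $N,m$ be positive integers, $\mathbb T^N=\mathbb R^N/\mathbb Z^N$ the flat torus, $\mathbb 1=(1,\dots,1)^T\in\mathbb R^m$. A convex Hamiltonian is a continuous $H:\mathbb T^N\times\mathbb R^N\to\mathbb R$ such that $p\mapsto H(x,p)$ is convex for every $x$ and there are $\alpha,\beta:\mathbb R_+\to\mathbb R$ tending to $+\infty$ at $+\infty$ with $\alpha(|p|)\leqslant H(x,p)\leqslant\beta(|p|)$ for all $(x,p)$. An $m\times m$ real matrix $(b_{ij})$ is a coupling matrix if $b_{ij}\leqslant0$ for $j\ne i$ and $\sum_j b_{ij}\geqslant0$ for every $i$; it is degenerate if moreover $\sum_j b_{ij}=0$ for every $i$; a matrix is irreducible if for every nonempty $\mathcal I\subsetneq\{1,\dots,m\}$ there are $i\in\mathcal I$, $j\notin\mathcal I$ with $b_{ij}\neq0$. Let $B(x)=(b_{ij}(x))$ have continuous coefficients on $\mathbb T^N$ and be an irreducible degenerate coupling matrix for every $x$. Write $(B(x)\mathbf u(x))_i=\sum_j b_{ij}(x)u_j(x)$. For continuous $u$, $D^+u(x_0)$ (resp. $D^-u(x_0)$) is the set of $D\phi(x_0)$ with $\phi$ of class $C^1$ near $x_0$ and $u-\phi$ having a local maximum (resp. minimum) at $x_0$. For $a\in\mathbb R$, $\mathbf u\in(C(\mathbb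 T^N))^m$ is a (viscosity) subsolution [resp. supersolution] of $H_i(x,Du_i)+(B(x)\mathbf u(x))_i=a$ in $\mathbb T^N$, $i=1,\dots,m$, if for all $x$ and $i$: $H_i(x,p)+(B(x)\mathbf u(x))_i\leqslant a$ for all $p\in D^+u_i(x)$ [resp. $\geqslant a$ for all $p\in D^-u_i(x)$]; a solution is both. $\mathcal H(a)$ denotes the set of subsolutions. The critical value of the system is $\inf\{a\in\mathbb R:\mathcal H(a)\neq\varnothing\}$. Similarly, the critical value of the scalar Hamiltonian $H$ is the infimum of the $a\in\mathbb R$ for which $H(x,Du)=a$ in $\mathbb T^N$ admits a continuous viscosity subsolution. It is assumed, by normalization, that the critical value of $H$ is $0$; then the critical value of the system is $0$ as well. ''Critical'' (sub)solutions of the system or of $H$ refer to $a=0$. Set $\Phi_{i,j}(y,x)=\sup_{\mathbf v\in\mathcal H(0)}\big(v_i(x)-v_j(y)\big)$ and $\Phi_{\cdot,j}(y,\cdot)=(\Phi_{1,j}(y,\cdot),\dots,\Phi_{m,j}(y,\cdot))^T$. The Aubry set of the system is $\mathcal A=\{y\in\mathbb T^N:\Phi_{\cdot,i}(y,\cdot)\text{ is a critical solution of the system}\}$, where $i$ is any fixed index (the set does not depend on $i$). $\mathcal A^*$ is the Aubry set of $H$: the set of $y\in\mathbb T^N$ such that $x\mapsto\sup\{v(x)-v(y): v\text{ critical subsolution of }H\}$ is a viscosity solution of $H(x,Du)=0$ in $\mathbb T^N$. *)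

(* Defs.v *)
From HB Require Import structures.
From mathcomp Require Import all_boot all_order all_algebra.
From mathcomp Require Import all_classical all_reals all_analysis.

Set Implicit Arguments.
Unset Strict Implicit.
Unset Printing Implicit Defensive.

Import Order.TTheory GRing.Theory Num.Theory.
Import numFieldNormedType.Exports.

Local Open Scope classical_set_scope.
Local Open Scope ring_scope.
Local Open Scope quotient_scope.

Section Torus.
Context (R : realType) (N : nat).

Definition lattice_eq (x y : 'rV[R]_N) : bool :=
  [forall i, (x 0 i - y 0 i) \is a Num.int].

Lemma lattice_eq_refl : reflexive lattice_eq.
Proof. by move=> x; apply/forallP => i; rewrite subrr rpred0. Qed.

Lemma lattice_eq_sym : symmetric lattice_eq.
Proof.
by move=> x y; apply/forallP/forallP => h i; rewrite -opprB rpredN.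
Qed.

Lemma lattice_eq_trans : transitive lattice_eq.
Proof.
move=> y x z /forallP xy /forallP yz; apply/forallP => i.
by rewrite -(subrKA (y 0 i)) rpredD.
Qed.

Canonical lattice_equiv :=
  EquivRel lattice_eq lattice_eq_refl lattice_eq_sym lattice_eq_trans.

Definition torus := quotient_topology {eq_quot lattice_equiv}.

HB.instance Definition _ := Topological.on torus.
HB.instance Definition _ := Quotient.on torus.

Definition torus_pi (x : 'rV[R]_N) : torus := \pi_torus x.

End Torus.

Section Semidifferentials.
Context (R : realType) (N : nat).
Implicit Types (f phi : 'rV[R]_N -> R) (u : torus R N -> R).

Definition grad phi (x : 'rV[R]_N) : 'rV[R]_N :=
  \row_i 'd phi x (delta_mx 0 i).

Definition C1_near phi (x0 : 'rV[R]_N) : Prop :=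
  \forall x \near x0, differentiable phi x /\ {for x, continuous (grad phi)}.

Definition local_max f (x0 : 'rV[R]_N) : Prop :=
  \forall x \near x0, f x <= f x0.

Definition local_min f (x0 : 'rV[R]_N) : Prop :=
  \forall x \near x0, f x0 <= f x.

(* Semidifferentials at a point of the torus are computed on the periodic lift
   of u, at a lift of the point; the result does not depend on the latter. *)
Definition superdiff u (y : torus R N) : set 'rV[R]_N :=
  [set p | exists x phi, [/\ torus_pi x = y, C1_near phi x,
     local_max (fun z => u (torus_pi z) - phi z) x & p = grad phi x]].

Definition subdiff u (y : torus R N) : set 'rV[R]_N :=
  [set p | exists x phi, [/\ torus_pi x = y, C1_near phi x,
     local_min (fun z => u (torus_pi z) - phi z) x & p = grad phi x]].

End Semidifferentials.

Section ConvexHamiltonian.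
Context (R : realType) (N : nat).

(* The library norm on 'rV[R]_N is the sup norm. *)
Definition euclidean_norm (p : 'rV[R]_N) : R :=
  Num.sqrt (\sum_i p 0 i ^+ 2).

(* Only the values of alpha and beta on the nonnegative reals matter. *)
Definition convex_hamiltonian (H : torus R N -> 'rV[R]_N -> R) : Prop :=
  [/\ continuous (fun z : torus R N * 'rV[R]_N => H z.1 z.2),
      forall x, convex_function [set: 'rV[R]_N] (H x) &
      exists alpha beta : R -> R,
        [/\ alpha r @[r --> +oo] --> +oo, beta r @[r --> +oo] --> +oo &
            forall x p, alpha (euclidean_norm p) <= H x p
                        /\ H x p <= beta (euclidean_norm p)]].

End ConvexHamiltonian.

Section CouplingMatrix.
Context (R : realType) (m : nat).
Implicit Types (b : 'M[R]_m).

Definition coupling_matrix b : Prop :=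
  (forall i j, j != i -> b i j <= 0) /\ (forall i, 0 <= \sum_j b i j).

Definition degenerate_coupling_matrix b : Prop :=
  coupling_matrix b /\ (forall i, \sum_j b i j = 0).

Definition irreducible_matrix b : Prop :=
  forall I : {set 'I_m}, I != finset.set0 -> I != [set: 'I_m]%SET ->
    exists i j, [/\ i \in I, j \notin I & b i j != 0].

End CouplingMatrix.

Section ScalarEquation.
Context (R : realType) (N : nat).
Variable H : torus R N -> 'rV[R]_N -> R.
Implicit Types (a : R) (u : torus R N -> R).

Definition subsolution a u : Prop :=
  continuous u /\ forall x p, superdiff u x p -> H x p <= a.

Definition supersolution a u : Prop :=
  continuous u /\ forall x p, subdiff u x p -> a <= H x p.

Definition solution a u : Prop := subsolution a u /\ supersolution a u.

Definition critical_value : \bar R :=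
  ereal_inf [set a%:E | a in [set a | exists u, subsolution a u]].

(* Extended-real-valued, so that the supremum is the true one. *)
Definition semidistance (y x : torus R N) : \bar R :=
  ereal_sup [set (v x - v y)%:E | v in subsolution 0].

Definition aubry_set : set (torus R N) :=
  [set y | exists w, (forall x, (w x)%:E = semidistance y x) /\ solution 0 w].

End ScalarEquation.

Section System.
Context (R : realType) (N m : nat).
Variables (H : 'I_m -> torus R N -> 'rV[R]_N -> R).
Variable B : torus R N -> 'M[R]_m.
Implicit Types (a : R) (u : 'I_m -> torus R N -> R).

Definition coupling u (i : 'I_m) (x : torus R N) : R :=
  \sum_j B x i j * u j x.

Definition sys_subsolution a u : Prop :=
  (forall i, continuous (u i)) /\
  forall x i p, superdiff (u i) x p -> H i x p + coupling u i x <= a.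

Definition sys_supersolution a u : Prop :=
  (forall i, continuous (u i)) /\
  forall x i p, subdiff (u i) x p -> a <= H i x p + coupling u i x.

Definition sys_solution a u : Prop :=
  sys_subsolution a u /\ sys_supersolution a u.

Definition Phi (i j : 'I_m) (y x : torus R N) : \bar R :=
  ereal_sup [set (v i x - v j y)%:E | v in sys_subsolution 0].

Definition sys_aubry_set (j : 'I_m) : set (torus R N) :=
  [set y | exists w : 'I_m -> torus R N -> R,
     (forall i x, (w i x)%:E = Phi i j y x) /\ sys_solution 0 w].

End System.

(* Main.v *)
Require Import Defs.
From HB Require Import structures.
From mathcomp Require Import all_boot all_order all_algebra.
From mathcomp Require Import all_classical all_reals all_analysis.
From mathcomp Require Import ring lra.
Import Order.TTheory GRing.Theory Num.Theory.
Import numFieldNormedType.Exports.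
Local Open Scope classical_set_scope.
Local Open Scope ring_scope.

Set Implicit Arguments.
Unset Strict Implicit.
Unset Printing Implicit Defensive.

(** All components of the system share the Hamiltonian, so the whole proposition
    rests on one comparison at a single point ([coupling_le_at_max]): if [f]
    satisfies [H(x, Df) + c <= 0], [g] satisfies [H(x, Dg) + d >= 0] and [f - g]
    is maximal at [y0], then [c y0 <= d y0].  Formally this is because [f] and
    [g] have the same gradient at [y0], where the two inequalities can be
    subtracted; doubling of variables makes it rigorous, coercivity keeping the
    test gradients in a compact set.

    The other ingredient is linear algebra.  For a degenerate coupling matrix
    [(B u)_i] is nonnegative at every index [i] where [u_i] is maximal among the
    components, nonpositive where it is minimal; and, by irreducibility, if it
    is nonpositive at all the maximal indices then all the components are equal
    ([irreducible_constant]).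

    Critical solutions are diagonal.  Let [u_i - u_j] be maximal over all pairs
    of indices and all points, at [y0]: [u_i] is then a largest and [u_j] a
    smallest component at [y0].  For each largest component [u_k] at [y0], the
    comparison of [u_k] with [u_j] yields [(B u)_k <= (B u)_j <= 0] at [y0], so
    all the components agree at [y0]; the maximal difference is zero and they
    agree everywhere.  Since [B] kills constant vectors, the common component
    solves the scalar equation.

    Aubry sets.  A scalar subsolution repeated [m] times is a subsolution of the
    system, so [Phi] dominates the scalar semidistance [S].  If [y] is in the
    Aubry set of the system, [Phi] is diagonal by the previous paragraph; its
    common component is a critical subsolution of [H] vanishing at [y], so it is
    also bounded above by [S] and the two coincide.  Conversely, let [S(y, .)]
    be a solution and let [u] be a critical subsolution of the system.  The
    maximum [s] of its components is a scalar subsolution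
    ([subsolution_max]), so [s - S(y, .)] is maximal at [y].  Each component
    which is largest at [y] can then be compared with [S(y, .)], which gives
    [(B u)_k <= 0] at [y]: all the components of [u] agree at [y].  Hence
    [u_i(x) - u_j(y) <= s(x) - s(y) <= S(y, x)], that is [Phi = S]. *)

(** * Quadratic test functions *)

(** Used instead of the norm, which is a sup norm and not differentiable. *)
Definition sqdist (R : realType) (N : nat) (x z : 'rV[R]_N) : R :=
  \sum_i (x 0 i - z 0 i) ^+ 2.

Lemma sqdist_ge0 (R : realType) (N : nat) (x z : 'rV[R]_N) : 0 <= sqdist x z.
Proof. by apply: sumr_ge0 => i _; exact: sqr_ge0. Qed.

Lemma sqdistxx (R : realType) (N : nat) (x : 'rV[R]_N) : sqdist x x = 0.
Proof. by apply: big1 => i _; rewrite subrr expr0n. Qed.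

Lemma sqdistC (R : realType) (N : nat) (x z : 'rV[R]_N) :
  sqdist x z = sqdist z x.
Proof. by apply: eq_bigr => i _; rewrite -opprB sqrrN. Qed.

Lemma sqdist_gt0 (R : realType) (N : nat) (x z : 'rV[R]_N) :
  x != z -> 0 < sqdist x z.
Proof.
move=> xz; rewrite lt_def sqdist_ge0 andbT; apply: contra_neq xz => /eqP.
rewrite psumr_eq0; last by move=> i _; exact: sqr_ge0.
move=> /allP h; apply/rowP => i; apply/eqP; rewrite -subr_eq0 -sqrf_eq0.
by apply: (implyP (h i (mem_index_enum i))).
Qed.

Lemma sqdist_continuous (R : realType) (N : nat) (T : topologicalType)
    (f g : T -> 'rV[R]_N) :
  continuous f -> continuous g -> continuous (fun t => sqdist (f t) (g t)).
Proof.
move=> cf cg; apply: continuous_big => [|i _ t]; first exact: add_continuous.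
rewrite /continuous_at; under eq_fun do rewrite expr2.
have c (h : T -> 'rV[R]_N) : continuous h -> h s 0 i @[s --> t] --> h t 0 i.
  move=> ch; apply: (@continuous_comp _ _ _ h (fun A : 'rV[R]_N => A 0 i)).
    exact: ch.
  exact: coord_continuous.
by rewrite expr2; apply: cvgM; apply: cvgB; exact: c.
Qed.

(** One formula serves both sides of the doubling of variables: with
    [a = n], [b = 1] it penalizes the distance to the second point and to the
    base point [w]; with [a = - n], [b = 0] it tests the second function. *)
Definition penalty (R : realType) (N : nat) (a b : R) (z w x : 'rV[R]_N) : R :=
  a * sqdist x z + b * sqdist x w.

Lemma is_diff_sqdist (R : realType) (N : nat) (z x : 'rV[R]_N) :
  is_diff x (fun y => sqdist y z : R)
    (fun h => \sum_i 2 * (x 0 i - z 0 i) * h 0 i).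
Proof.
have coordP i : is_diff x (fun y : 'rV[R]_N => y 0 i : R) (fun h => h 0 i).
  have @f : {linear 'rV[R]_N -> R}.
    by exists (fun A : 'rV[R]_N => A 0 i); do 2![eexists]; do ?[constructor];
      rewrite ?mxE// => ? *; rewrite ?mxE//; move=> ?; rewrite !mxE.
  have cf : continuous f by exact: coord_continuous.
  apply: DiffDef; first exact: differentiable_coord.
  by rewrite -[LHS]/('d f x : _ -> _) diff_lin.
have sqP i : is_diff x (fun y : 'rV[R]_N => (y 0 i - z 0 i) ^+ 2 : R)
    (fun h => 2 * (x 0 i - z 0 i) * h 0 i).
  have := @is_diffX _ _ _ _ 1 x
    (@is_diffB _ _ _ _ _ _ _ x (coordP i) (@is_diff_cst _ _ _ (z 0 i) x)).
  move=> /is_diff_eq; apply; apply/funext => h.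
  by rewrite /= !fctE subr0 expr1.
rewrite /sqdist -fct_sumE.
have -> : (fun h : 'rV[R]_N => \sum_i 2 * (x 0 i - z 0 i) * h 0 i)
    = \sum_i (fun h : 'rV[R]_N => 2 * (x 0 i - z 0 i) * h 0 i).
  by rewrite fct_sumE.
by apply: big_ind2.
Qed.

Lemma is_diff_penalty (R : realType) (N : nat) (a b : R) (z w x : 'rV[R]_N) :
  is_diff x (penalty a b z w)
    (fun h => \sum_i (2 * a * (x 0 i - z 0 i) + 2 * b * (x 0 i - w 0 i)) * h 0 i).
Proof.
have := @is_diffD _ _ _ _ _ _ _ x
  (@is_diffZ _ _ _ _ _ a x (is_diff_sqdist z x))
  (@is_diffZ _ _ _ _ _ b x (is_diff_sqdist w x)).
move=> /is_diff_eq; apply; apply/funext => h.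
rewrite !fctE /GRing.scale /= !mulr_sumr -big_split /=.
by apply: eq_bigr => i _; ring.
Qed.

Lemma grad_penalty (R : realType) (N : nat) (a b : R) (z w x : 'rV[R]_N) :
  grad (penalty a b z w) x = (2 * a) *: (x - z) + (2 * b) *: (x - w).
Proof.
apply/rowP => i; rewrite !mxE.
have -> := @diff_val _ _ _ _ _ _ _ (is_diff_penalty a b z w x).
rewrite (bigD1 i)//= big1 ?addr0 => [|j ji].
  by rewrite mxE !eqxx mulr1; ring.
by rewrite mxE (negbTE ji) andbF mulr0.
Qed.

Lemma C1_penalty (R : realType) (N : nat) (a b : R) (z w x : 'rV[R]_N) :
  C1_near (penalty a b z w) x.
Proof.
apply: (@filterE _ (nbhs x)) => y; split.
  exact: (@ex_diff _ _ _ _ _ _ _ (is_diff_penalty a b z w y)).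
rewrite (_ : grad _ = fun y => (2 * a) *: (y - z) + (2 * b) *: (y - w)).
  have c s w' : {for y, continuous (fun t : 'rV[R]_N => s *: (t - w'))}.
    by apply: continuousZl_tmp; apply: continuousB; [by move=> ?|exact: cst_continuous].
  by apply: continuousD; exact: c.
by apply/funext => ?; exact: grad_penalty.
Qed.

(** * Doubling of variables *)

Lemma closed_ball_rV_compact (R : realType) (N : nat) (x : 'rV[R]_N) (e : R) :
  0 < e -> compact (closed_ball x e).
Proof.
move=> e0; apply: bounded_closed_compact; last exact: closed_ball_closed.
exists (`|x| + e); split; first exact: num_real.
move=> M xM y; rewrite closed_ballE//= => xy.
apply: le_trans (ltW xM); rewrite -[y](subKr x).
by apply: le_trans (ler_normB _ _) _; rewrite lerD2l.
Qed.

(** Points which beat the diagonal value [F x0 - G x0] concentrate at [x0] as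
    [n] grows: off the diagonal the term [n |x - z|^2] wins, and on the diagonal,
    away from [x0], the term [|x - x0|^2] breaks the ties of [F - G].  Both are
    open conditions, so compactness of [K] makes [n] uniform. *)
Lemma penalized_max_localized (R : realType) (N : nat) (F G : 'rV[R]_N -> R)
    (K : set ('rV[R]_N * 'rV[R]_N)) (x0 : 'rV[R]_N) (e : R) :
  continuous F -> continuous G -> compact K ->
  (forall x, K (x, x) -> F x - G x <= F x0 - G x0) -> 0 < e ->
  \forall n \near +oo, forall x z, K (x, z) ->
    F x0 - G x0 <= F x - G z - penalty n 1 z x0 x ->
    ball x0 e x /\ ball x0 e z.
Proof.
move=> cF cG cK FG e0.
pose near0 (t : 'rV[R]_N * 'rV[R]_N) := ball x0 e t.1 /\ ball x0 e t.2.
pose P (n : R) (t : 'rV[R]_N * 'rV[R]_N) :=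
  F x0 - G x0 <= F t.1 - G t.2 - penalty n 1 t.2 x0 t.1 -> near0 t.
suff : \forall n \near +oo, K `<=` P n.
  by apply: filterS => n KP x z Kxz; exact: (KP _ Kxz).
have /compact_near_coveringP := cK; apply => -[x z] Kxz.
have c1 : continuous (@fst 'rV[R]_N 'rV[R]_N) by move=> ?; exact: cvg_fst.
have c2 : continuous (@snd 'rV[R]_N 'rV[R]_N) by move=> ?; exact: cvg_snd.
have cst0 : continuous (fun _ : 'rV[R]_N * 'rV[R]_N => x0)
  by move=> ?; exact: cvg_cst.
have cFG : continuous (fun t : 'rV[R]_N * 'rV[R]_N => F t.1 - G t.2).
  move=> t; apply: cvgB.
    by apply: (@continuous_comp _ _ _ fst F); [exact: c1|exact: cF].
  by apply: (@continuous_comp _ _ _ snd G); [exact: c2|exact: cG].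
have cxz := @sqdist_continuous R N _ _ _ c1 c2.
have cx0 := @sqdist_continuous R N _ _ _ c1 cst0.
have [xz|xz] := eqVneq x z; last first.
- (* the margin 1 leaves room for the variation of F - G near (x, z) *)
  set d := sqdist x z; have d0 : 0 < d by exact: sqdist_gt0.
  near=> t n => /=; rewrite /P /penalty.
  have tF : F t.1 - G t.2 < F x - G z + 1.
    near: t; have /cvgr_lt := cFG (x, z); apply.
    by rewrite ltrDl.
  have td : d / 2 < sqdist t.1 t.2.
    near: t; have /cvgr_gt := cxz (x, z); apply.
    by rewrite /= -/d; lra.
  have n0 : 0 <= n by near: n; exact: nbhs_pinfty_ge.
  have nd : F x - G z + 1 - (F x0 - G x0) < n * (d / 2).
    rewrite -ltr_pdivrMr; last by lra.
    by near: n; apply: nbhs_pinfty_gt; exact: num_real.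
  have nt : n * (d / 2) <= n * sqdist t.1 t.2.
    by apply: ler_wpM2l => //; exact: ltW.
  by have := sqdist_ge0 t.1 x0; lra.
- (* on the diagonal |x - x0|^2 alone has to give the strict inequality *)
  rewrite -{z}xz in Kxz *.
  have [xx0|xx0] := eqVneq x x0.
    have near_x0 : \forall t \near (x, x), near0 t.
      by rewrite xx0; exists (ball x0 e, ball x0 e) => //; split; exact: nbhsx_ballx.
    by near=> t n => _; apply: (near near_x0 t).
  set d := sqdist x x0; have d0 : 0 < d by exact: sqdist_gt0.
  have h : continuous (fun t : 'rV[R]_N * 'rV[R]_N =>
      F t.1 - G t.2 - sqdist t.1 x0).
    by move=> s; apply: cvgB; [exact: cFG|exact: cx0].
  near=> t n => /=; rewrite /P /penalty.
  have tF : F t.1 - G t.2 - sqdist t.1 x0 < F x0 - G x0.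
    near: t; have /cvgr_lt := h (x, x); apply.
    by rewrite /= -/d; have := FG _ Kxz; lra.
  have n0 : 0 <= n by near: n; exact: nbhs_pinfty_ge.
  have := mulr_ge0 n0 (sqdist_ge0 t.1 t.2); lra.
Unshelve. all: by end_near. Qed.

(** The points [x] and [z] maximize [F x - G z - n |x - z|^2 - |x - x0|^2]; the
    two test functions are this penalty with one of its variables frozen. *)
Lemma doubling_variables (R : realType) (N : nat) (F G : 'rV[R]_N -> R)
    (x0 : 'rV[R]_N) (e : R) :
  continuous F -> continuous G ->
  local_max (fun x => F x - G x) x0 -> 0 < e ->
  exists n x z, [/\ ball x0 e x, ball x0 e z,
    local_max (fun y => F y - penalty n 1 z x0 y) x &
    local_min (fun y => G y - penalty (- n) 0 x x0 y) z].
Proof.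
move=> cF cG /nbhs_ballP[r /= r0 FG] e0.
pose s := Num.min (r / 2) e.
have s0 : 0 < s by rewrite lt_min e0 andbT divr_gt0.
have sr : s < r by rewrite gt_min ltr_pdivrMr// ltr_pMr// ltr1n.
have se : s <= e by rewrite ge_min lexx orbT.
set K := closed_ball x0 s.
have KE y : K y <-> `|x0 - y| <= s by rewrite /K closed_ballE.
have bK : ball x0 s `<=` K.
  by move=> y; rewrite -ball_normE => xy; apply/KE; exact: ltW.
have cK : compact (K `*` K) by apply: compact_setX; exact: closed_ball_rV_compact.
have FGK x : (K `*` K) (x, x) -> F x - G x <= F x0 - G x0.
  move=> -[/KE xK _]; apply: FG; rewrite -ball_normE /=.
  exact: le_lt_trans xK sr.
have locn := @penalized_max_localized R N F G (K `*` K) x0 s cF cG cK FGK s0.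
have [n nP] : exists n, forall x z, (K `*` K) (x, z) ->
    F x0 - G x0 <= F x - G z - penalty n 1 z x0 x ->
    ball x0 s x /\ ball x0 s z.
  exact: (@filter_ex _ _ _ _ locn).
pose Psi (t : 'rV[R]_N * 'rV[R]_N) := F t.1 - G t.2 - penalty n 1 t.2 x0 t.1.
have cPsi : continuous Psi.
  have c1 : continuous (@fst 'rV[R]_N 'rV[R]_N) by move=> ?; exact: cvg_fst.
  have c2 : continuous (@snd 'rV[R]_N 'rV[R]_N) by move=> ?; exact: cvg_snd.
  have c0 : continuous (fun _ : 'rV[R]_N * 'rV[R]_N => x0).
    by move=> ?; exact: cvg_cst.
  move=> t; apply: cvgB; first apply: cvgB.
  - by apply: (@continuous_comp _ _ _ fst F); [exact: c1|exact: cF].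
  - by apply: (@continuous_comp _ _ _ snd G); [exact: c2|exact: cG].
  - apply: cvgD; (apply: cvgM; first exact: cvg_cst).
      exact: (@sqdist_continuous R N _ _ _ c1 c2).
    exact: (@sqdist_continuous R N _ _ _ c1 c0).
have K0 : (K `*` K) (x0, x0) by split; apply: bK; exact: ballxx.
have [[x z] xzK Pmax] := @compact_EVT_max _ _ Psi (K `*` K)
  (ex_intro _ _ K0) cK (continuous_subspaceT cPsi).
have {}Pmax x' z' : K x' -> K z' -> Psi (x', z') <= Psi (x, z).
  by move=> ? ?; apply: Pmax; rewrite inE.
rewrite inE in xzK.
have [bx bz] : ball x0 s x /\ ball x0 s z.
  apply: nP => //; have := Pmax x0 x0 K0.1 K0.2.
  by rewrite /Psi /penalty /= !sqdistxx !mulr0 addr0 subr0.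
have nK y : ball x0 s y -> nbhs y K.
  move=> by0; apply: (@filterS _ _ _ (ball x0 s)) => //.
  by apply: open_nbhs_nbhs; split => //; exact: ball_open.
exists n, x, z; split.
- exact: le_ball bx.
- exact: le_ball bz.
- apply: filterS (nK _ bx) => y yK.
  by have := Pmax y z yK xzK.2; rewrite /Psi /=; lra.
- apply: filterS (nK _ bz) => y yK.
  have := Pmax x y xzK.1 yK; rewrite /Psi /penalty /= !(sqdistC x).
  by lra.
Qed.

(** * Comparison of zeroth-order terms at a maximum *)

Lemma le_euclidean_norm (R : realType) (N : nat) (p : 'rV[R]_N) :
  `|p| <= euclidean_norm p.
Proof.
rewrite /Num.Def.normr /= mx_normrE; apply: bigmax_le => [|[i j] _].
  exact: sqrtr_ge0.
rewrite /= ord1 -sqrtr_sqr /euclidean_norm ler_wsqrtr// (bigD1 j)//= lerDl.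
by apply: sumr_ge0 => k _; exact: sqr_ge0.
Qed.

Lemma torus_pi_continuous (R : realType) (N : nat) : continuous (@torus_pi R N).
Proof. exact: pi_continuous. Qed.

Lemma comp_torus_pi_continuous (R : realType) (N : nat) (S T : topologicalType)
    (f : torus R N -> T) (x : S -> 'rV[R]_N) :
  continuous f -> continuous x -> continuous (fun s => f (torus_pi (x s))).
Proof.
move=> cf cx s; have cpix : continuous (fun s => torus_pi (x s)).
  by move=> r; apply: continuous_comp; [exact: cx|exact: torus_pi_continuous].
by apply: (@continuous_comp _ _ _ (fun s => torus_pi (x s)) f);
  [exact: cpix|exact: cf].
Qed.

Lemma continuous_fst_comp (T U V : topologicalType) (f : T -> U * V) :
  continuous f -> continuous (fun t => (f t).1).
Proof.
by move=> cf t; apply: (@continuous_comp _ _ _ f fst); [exact: cf|exact: cvg_fst].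
Qed.

Lemma continuous_snd_comp (T U V : topologicalType) (f : T -> U * V) :
  continuous f -> continuous (fun t => (f t).2).
Proof.
by move=> cf t; apply: (@continuous_comp _ _ _ f snd); [exact: cf|exact: cvg_snd].
Qed.

Lemma hamiltonian_term_continuous (R : realType) (N : nat) (T : topologicalType)
    (H : torus R N -> 'rV[R]_N -> R) (c : torus R N -> R) (x p : T -> 'rV[R]_N) :
  continuous (fun z : torus R N * 'rV[R]_N => H z.1 z.2) -> continuous c ->
  continuous x -> continuous p ->
  continuous (fun t => H (torus_pi (x t)) (p t) + c (torus_pi (x t))).
Proof.
move=> cH cc cx cp t.
have cpix : continuous (fun t => torus_pi (x t)).
  by apply: (comp_torus_pi_continuous (f := id)) => // ?; exact: cvg_id.
apply: cvgD; last by apply: comp_torus_pi_continuous.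
apply: (@continuous_comp _ _ _ (fun s => (torus_pi (x s), p s)) (fun z => H z.1 z.2)).
  apply: (@cvg_pair _ _ _ (nbhs t) (nbhs (torus_pi (x t))) (nbhs (p t))).
    exact: cpix.
  exact: cp.
exact: cH.
Qed.

(** If [d y0 < c y0], then [H(x, p) + c(x) > H(z, p + r) + d(z)] for [x], [z]
    near a lift of [y0], [r] small and [p] bounded, uniformly in [p] by
    compactness.  The two gradients given by the doubling of variables
    contradict this. *)
Lemma coupling_le_at_max (R : realType) (N : nat)
    (H : torus R N -> 'rV[R]_N -> R) (f g c d : torus R N -> R) (y0 : torus R N) :
  convex_hamiltonian H ->
  continuous f -> continuous g -> continuous c -> continuous d ->
  (forall y p, superdiff f y p -> H y p + c y <= 0) ->
  (forall y p, subdiff g y p -> 0 <= H y p + d y) ->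
  (forall y, f y - g y <= f y0 - g y0) ->
  c y0 <= d y0.
Proof.
move=> [cH _ [alpha [beta [alphaoo _ alphaH]]]] cf cg cc cd fsub gsup fg.
rewrite leNgt; apply/negP => dc.
pose pi := @torus_pi R N.
pose x0 : 'rV[R]_N := repr y0.
have pix0 : pi x0 = y0 by exact: reprK.
(* near y0 one has c > c y0 - 1, so that H(x, p) + c(x) <= 0 bounds |p| by M *)
have [M [_ alphaM]] : \forall r \near +oo, 1 - c y0 < alpha r.
  by move/cvgryPgt: alphaoo; apply.
(* M may be negative, while a closed ball needs a positive radius *)
pose C := Num.max M 1.
have C0 : 0 < C by rewrite lt_max ltr01 orbT.
pose K : set 'rV[R]_N := closed_ball 0 C.
pose P (t : 'rV[R]_N * 'rV[R]_N * 'rV[R]_N) (p : 'rV[R]_N) : Prop :=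
  H (pi t.1.2) (p + t.2) + d (pi t.1.2) < H (pi t.1.1) p + c (pi t.1.1).
have KP : \forall t \near (x0, x0, 0 : 'rV[R]_N), K `<=` P t.
  have /compact_near_coveringP covK : compact K by exact: closed_ball_rV_compact.
  apply: (covK _ (nbhs (x0, x0, 0 : 'rV[R]_N)) P _) => p _.
  pose T := ('rV[R]_N * ('rV[R]_N * 'rV[R]_N * 'rV[R]_N))%type.
  pose L1 (s : T) := H (pi s.2.1.1) s.1 + c (pi s.2.1.1).
  pose L2 (s : T) := H (pi s.2.1.2) (s.1 + s.2.2) + d (pi s.2.1.2).
  pose L s := L1 s - L2 s.
  have c1 : continuous (fun s : T => s.1) by move=> ?; exact: cvg_fst.
  have c2 : continuous (fun s : T => s.2) by move=> ?; exact: cvg_snd.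
  have c22 : continuous (fun s : T => s.2.2) := continuous_snd_comp c2.
  have c21 : continuous (fun s : T => s.2.1) := continuous_fst_comp c2.
  have c211 : continuous (fun s : T => s.2.1.1) := continuous_fst_comp c21.
  have c212 : continuous (fun s : T => s.2.1.2) := continuous_snd_comp c21.
  have c122 : continuous (fun s : T => s.1 + s.2.2).
    by move=> s; apply: cvgD; [exact: c1|exact: c22].
  have cL : continuous L.
    have cL1 := hamiltonian_term_continuous cH cc c211 c1.
    have cL2 := hamiltonian_term_continuous cH cd c212 c122.
    by move=> s; apply: cvgB; [exact: cL1|exact: cL2].
  have L0 : 0 < L (p, (x0, x0, 0)).
    by rewrite /L /L1 /L2 /= pix0 addr0; lra.
  have : \forall s \near (p, (x0, x0, 0 : 'rV[R]_N)), 0 < L s.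
    by have /cvgr_gt := cL (p, (x0, x0, 0)); apply.
  apply: filterS => -[q t]; rewrite /L /L1 /L2 /P /= => ?; lra.
have cP : \forall t \near (x0, x0, 0 : 'rV[R]_N), c y0 - 1 < c (pi t.1.1).
  have h : continuous (fun t : 'rV[R]_N * 'rV[R]_N * 'rV[R]_N => c (pi t.1.1)).
    apply: (comp_torus_pi_continuous cc (x := fun t => t.1.1)).
    by apply: continuous_fst_comp => ?; exact: cvg_fst.
  have /cvgr_gt := h (x0, x0, 0); apply.
  by rewrite /= pix0; lra.
have [e /= e0 eP] :=
  iffLR (@nbhs_ballP _ ('rV[R]_N * 'rV[R]_N * 'rV[R]_N)%type (x0, x0, 0) _)
    (filterI KP cP).
(* the two gradients differ by twice the distance of x to x0 *)
have e20 : 0 < e / 2 by lra.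
have e2e : e / 2 <= e by lra.
have [||||n [x [z [bx bz Fx Gz]]]] := @doubling_variables R N
    (fun x => f (pi x)) (fun x => g (pi x)) x0 (e / 2).
- by apply: (comp_torus_pi_continuous (x := id)) => // ?; exact: cvg_id.
- by apply: (comp_torus_pi_continuous (x := id)) => // ?; exact: cvg_id.
- by apply: (@filterE _ (nbhs x0)) => x; rewrite pix0.
- exact: e20.
pose p := grad (penalty n 1 z x0) x.
pose q := grad (penalty (- n) 0 x x0) z.
have pE : q = p + 2 *: (x0 - x).
  rewrite /p /q !grad_penalty mulr0 scale0r mulr1 addr0.
  by apply/rowP => i; rewrite !mxE; ring.
have Hp : H (pi x) p + c (pi x) <= 0.
  apply: fsub; exists x, (penalty n 1 z x0); split => //.
  exact: C1_penalty.
have Hq : 0 <= H (pi z) q + d (pi z).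
  apply: gsup; exists z, (penalty (- n) 0 x x0); split => //.
  exact: C1_penalty.
have bq : ball 0 e (2 *: (x0 - x)).
  move: bx; rewrite -!ball_normE /= sub0r normrN normrZ ger0_norm//.
  by rewrite ltr_pdivlMr// mulrC.
have [KPt cPt] : K `<=` P (x, z, 2 *: (x0 - x)) /\ c y0 - 1 < c (pi x).
  exact: (eP (x, z, 2 *: (x0 - x))
    (conj (conj (le_ball e2e bx) (le_ball e2e bz)) bq)).
have /KPt : K p.
  rewrite /K closed_ballE//= /closed_ball_ /= sub0r normrN.
  apply: le_trans (le_euclidean_norm _) _.
  rewrite le_max; apply/orP; left; rewrite leNgt; apply/negP => /alphaM.
  rewrite ltNge => /negP; apply; have [+ _] := alphaH (pi x) p => /le_trans; apply.
  by clear -Hp cPt; lra.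
rewrite /P /= -pE => HPt.
by have := le_lt_trans Hq HPt; rewrite ltNge Hp.
Qed.

(** * Compactness of the torus *)

Lemma torus_compact (R : realType) (N : nat) : compact [set: torus R N].
Proof.
have -> : [set: torus R N] = @torus_pi R N @` closed_ball 0 1.
  apply/seteqP; split => // y _.
  pose x : 'rV[R]_N := repr y.
  exists (\row_i (x 0 i - (Num.floor (x 0 i))%:~R)) => [|/=].
    rewrite closed_ballE// /closed_ball_ /= sub0r normrN.
    rewrite /Num.Def.normr /= mx_normrE; apply: bigmax_le => // -[k i] _.
    rewrite mxE ger0_norm ?subr_ge0 ?ge_floor//= lerBlDl.
    by have /ltW := lt_succ_floor (x 0 i); rewrite intrD.
  rewrite -[RHS]reprK; apply/(@eqmodP _ (lattice_equiv R N)) => /=.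
  by apply/forallP => i; rewrite mxE addrAC subrr sub0r rpredN intr_int.
apply: continuous_compact; last exact: closed_ball_rV_compact.
by apply: continuous_subspaceT; exact: torus_pi_continuous.
Qed.

Lemma torus_argmax (R : realType) (N : nat) (f : torus R N -> R) :
  continuous f -> exists x, forall y, f y <= f x.
Proof.
move=> cf.
have T0 : [set: torus R N] !=set0 by exists (torus_pi 0).
have [x _ xP] := compact_EVT_max T0 (@torus_compact R N) (continuous_subspaceT cf).
by exists x => y; apply: xP; rewrite inE.
Qed.

(** * Degenerate irreducible coupling matrices *)

Lemma degenerate_row_sumE (R : realType) (m : nat) (b : 'M[R]_m)
    (u : 'I_m -> R) (i : 'I_m) :
  degenerate_coupling_matrix b ->
  \sum_j b i j * u j = \sum_j b i j * (u j - u i).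
Proof.
move=> [_ b0]; under [RHS]eq_bigr do rewrite mulrBr.
by rewrite sumrB -mulr_suml b0 mul0r subr0.
Qed.

Lemma degenerate_row_term_ge0 (R : realType) (m : nat) (b : 'M[R]_m)
    (u : 'I_m -> R) (i j : 'I_m) :
  degenerate_coupling_matrix b -> u j <= u i -> 0 <= b i j * (u j - u i).
Proof.
move=> [[b_le0 _] _] uj; have [->|ji] := eqVneq j i.
  by rewrite subrr mulr0.
by apply: mulr_le0; [exact: b_le0|rewrite subr_le0].
Qed.

Lemma degenerate_row_ge0 (R : realType) (m : nat) (b : 'M[R]_m)
    (u : 'I_m -> R) (i : 'I_m) :
  degenerate_coupling_matrix b -> (forall j, u j <= u i) ->
  0 <= \sum_j b i j * u j.
Proof.
move=> bP ui; rewrite degenerate_row_sumE//.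
by apply: sumr_ge0 => j _; exact: degenerate_row_term_ge0.
Qed.

Lemma degenerate_row_le0 (R : realType) (m : nat) (b : 'M[R]_m)
    (u : 'I_m -> R) (i : 'I_m) :
  degenerate_coupling_matrix b -> (forall j, u i <= u j) ->
  \sum_j b i j * u j <= 0.
Proof.
move=> bP ui; rewrite -oppr_ge0 -sumrN.
under eq_bigr do rewrite -mulrN.
by apply: (@degenerate_row_ge0 _ _ _ (fun j => - u j)) => // j; rewrite lerN2.
Qed.

(** If some component were smaller than [M], irreducibility would link it to a
    maximal index, whose row sum, written with the differences [u j - M], has a
    positive term and no negative one. *)
Lemma irreducible_constant (R : realType) (m : nat) (b : 'M[R]_m)
    (u : 'I_m -> R) (M : R) :
  degenerate_coupling_matrix b -> irreducible_matrix b ->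
  (forall j, u j <= M) -> (exists i, u i = M) ->
  (forall i, u i = M -> \sum_j b i j * u j <= 0) ->
  forall j, u j = M.
Proof.
move=> bP birr uM [i0 i0M] bu.
pose I : {set 'I_m} := [set i | u i == M]%SET.
suff IT : I = [set: 'I_m]%SET.
  by move=> j; apply/eqP; have := finset.in_setT j; rewrite -IT finset.inE.
apply/eqP; apply: contraT => IT.
have I0 : I != finset.set0 by apply/finset.set0Pn; exists i0; rewrite finset.inE i0M.
have [i [j []]] := birr I I0 IT.
rewrite !finset.inE => /eqP iM jM bij.
have ujM : u j < u i by rewrite iM lt_neqAle jM uM.
have := bu i iM; rewrite degenerate_row_sumE// leNgt => /negP; case.
rewrite (bigD1 j)//= ltr_wpDr//.
  by apply: sumr_ge0 => k _; apply: degenerate_row_term_ge0; rewrite ?iM.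
have ji : j != i by apply: contraTneq ujM => ->; rewrite ltxx.
rewrite -mulrNN mulr_gt0 ?oppr_gt0 ?subr_lt0//.
by rewrite lt_neqAle bij; case: bP => -[-> //].
Qed.

(** * Coupled and scalar equations *)

Lemma continuous_sub (R : realType) (T : topologicalType) (f g : T -> R) :
  continuous f -> continuous g -> continuous (fun x => f x - g x).
Proof. by move=> cf cg x; apply: cvgB; [exact: cf|exact: cg]. Qed.

Lemma continuous_sum_mul (R : realType) (m : nat) (T : topologicalType)
    (b u : 'I_m -> T -> R) :
  (forall j, continuous (b j)) -> (forall j, continuous (u j)) ->
  continuous (fun x => \sum_j b j x * u j x).
Proof.
move=> cb cu; apply: continuous_big => [|j _ x]; first exact: add_continuous.
by apply: cvgM; [exact: cb|exact: cu].
Qed.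

Lemma coupling_continuous (R : realType) (N m : nat)
    (B : torus R N -> 'M[R]_m) (u : 'I_m -> torus R N -> R) (i : 'I_m) :
  (forall i j, continuous (fun x => B x i j)) -> (forall i, continuous (u i)) ->
  continuous (coupling B u i).
Proof. by move=> cB cu; exact: (continuous_sum_mul (cB i) cu). Qed.

Lemma coupling_diagonal (R : realType) (N m : nat)
    (B : torus R N -> 'M[R]_m) (v : torus R N -> R) (i : 'I_m) (x : torus R N) :
  degenerate_coupling_matrix (B x) -> coupling B (fun=> v) i x = 0.
Proof. by move=> [_ B0]; rewrite /coupling -mulr_suml B0 mul0r. Qed.

Lemma sys_subsolution_diagonal (R : realType) (N m : nat)
    (H : torus R N -> 'rV[R]_N -> R) (Hs : 'I_m -> torus R N -> 'rV[R]_N -> R)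
    (B : torus R N -> 'M[R]_m) (a : R) (v : torus R N -> R) :
  (forall x, degenerate_coupling_matrix (B x)) -> (forall i, Hs i = H) ->
  subsolution H a v -> sys_subsolution Hs B a (fun=> v).
Proof.
move=> Bdeg HsE [cv vsub]; split=> // x i p /vsub.
by rewrite HsE coupling_diagonal// addr0.
Qed.

Lemma sys_solution_diagonal (R : realType) (N m : nat)
    (H : torus R N -> 'rV[R]_N -> R) (Hs : 'I_m -> torus R N -> 'rV[R]_N -> R)
    (B : torus R N -> 'M[R]_m) (a : R) (v : torus R N -> R) :
  (0 < m)%N ->
  (forall x, degenerate_coupling_matrix (B x)) -> (forall i, Hs i = H) ->
  sys_solution Hs B a (fun=> v) <-> solution H a v.
Proof.
move=> m0 Bdeg HsE; pose i0 := Ordinal m0.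
split=> [[[cv vsub] [_ vsup]]|[vsub [cv vsup]]].
  split; split=> [|x p xp]; try exact: (cv i0).
    by have := vsub x i0 p xp; rewrite HsE coupling_diagonal// addr0.
  by have := vsup x i0 p xp; rewrite HsE coupling_diagonal// addr0.
split; first exact: sys_subsolution_diagonal vsub.
by split=> // x i p /vsup; rewrite HsE coupling_diagonal// addr0.
Qed.

Lemma continuous_bigmax (R : realType) (I : Type) (T : topologicalType)
    (r : seq I) (u0 : T -> R) (u : I -> T -> R) :
  continuous u0 -> (forall i, continuous (u i)) ->
  continuous (fun x => \big[Num.max/u0 x]_(i <- r) u i x).
Proof.
move=> cu0 cu; elim: r => [|i r IH] x; rewrite /continuous_at.
  by under eq_fun do rewrite big_nil; rewrite big_nil; exact: cu0.
under eq_fun do rewrite big_cons.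
by rewrite big_cons; apply: continuous_max; [exact: cu|exact: IH].
Qed.

(** A test function touching the maximum from above also touches the component
    that realizes it, and there the coupling term is nonnegative. *)
Lemma subsolution_max (R : realType) (N m : nat)
    (H : torus R N -> 'rV[R]_N -> R) (Hs : 'I_m -> torus R N -> 'rV[R]_N -> R)
    (B : torus R N -> 'M[R]_m) (a : R) (u : 'I_m -> torus R N -> R) :
  (0 < m)%N ->
  (forall x, degenerate_coupling_matrix (B x)) -> (forall i, Hs i = H) ->
  sys_subsolution Hs B a u ->
  exists w : torus R N -> R, [/\ subsolution H a w,
    forall i x, u i x <= w x & forall x, exists i, u i x = w x].
Proof.
move=> m0 Bdeg HsE [cu usub]; pose i0 := Ordinal m0.
pose w x := \big[Num.max/u i0 x]_i u i x.
have uw i x : u i x <= w x by exact: le_bigmax.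
have wu x : exists i, u i x = w x.
  rewrite /w; elim/big_ind: _ => [|p q [i ip] [j jq]|i _].
  - by exists i0.
  - by rewrite maxEle; case: ifP => _; [exists j|exists i].
  - by exists i.
exists w; split=> //; split.
  exact: continuous_bigmax.
move=> y p [x [phi [xy phiC1 wmax ->]]].
have [i iw] := wu y.
have : superdiff (u i) y (grad phi x).
  exists x, phi; split=> //; apply: filterS wmax => z.
  by rewrite xy -iw; apply: le_trans; rewrite lerB.
move=> /(usub y i); rewrite HsE; apply: le_trans; rewrite lerDl.
by apply: degenerate_row_ge0 => // j; rewrite iw.
Qed.

(** * Equality of the components *)

(** Maximizing [u_i - u_j] over the indices as well as over the points is what
    makes the maximizing indices extremal at the maximum point, so that the sign
    of their coupling terms is known there. *)
Lemma sys_solution_all_equal (R : realType) (N m : nat)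
    (H : torus R N -> 'rV[R]_N -> R) (Hs : 'I_m -> torus R N -> 'rV[R]_N -> R)
    (B : torus R N -> 'M[R]_m) (u : 'I_m -> torus R N -> R) :
  (forall i j, continuous (fun x => B x i j)) ->
  (forall x, degenerate_coupling_matrix (B x)) ->
  (forall x, irreducible_matrix (B x)) ->
  convex_hamiltonian H -> (forall i, Hs i = H) ->
  sys_solution Hs B 0 u -> forall i j, u i = u j.
Proof.
move=> cB Bdeg Birr convH HsE [[cu usub] [_ usup]] i0 j0.
suff le : forall k l x, u k x <= u l x.
  by apply/funext => x; apply/eqP; rewrite eq_le !le.
pose D (ij : 'I_m * 'I_m) x := u ij.1 x - u ij.2 x.
have Dargmax ij : exists x, forall y, D ij y <= D ij x.
  by apply: torus_argmax; exact: continuous_sub.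
have [X XP] := boolp.choice Dargmax.
have [[i j] _ ijP] := @arg_maxP _ _ _ (i0, i0) xpredT (fun ij => D ij (X ij)) isT.
set y0 := X (i, j) in ijP.
have Dmax k l y : u k y - u l y <= u i y0 - u j y0.
  exact: le_trans (XP (k, l) y) (ijP (k, l) isT).
have maxi k : u k y0 <= u i y0 by have := Dmax k j y0; rewrite lerD2r.
have minj k : u j y0 <= u k y0 by have := Dmax i k y0; rewrite lerD2l lerN2.
have eqy0 : forall k, u k y0 = u i y0.
  apply: (irreducible_constant (b := B y0)) => //; first by exists i.
  move=> k ki.
  apply: le_trans (degenerate_row_le0 (Bdeg y0) minj).
  apply: (coupling_le_at_max (f := u k) (g := u j) (H := H)
    (c := coupling B u k) (d := coupling B u j)) => //.
  - exact: coupling_continuous.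
  - exact: coupling_continuous.
  - by move=> y p /(usub y k); rewrite HsE.
  - by move=> y p /(usup y j); rewrite HsE.
  - by move=> y; rewrite ki.
by move=> k l x; have := Dmax k l x; rewrite (eqy0 j) subrr subr_le0.
Qed.

(** For [y] in the Aubry set of [H], this is applied to [v = S(y, .)] and to the
    maximum [w] of the components: subsolutions of the system cannot have
    distinct components at such a point. *)
Lemma components_equal_at_touching_point (R : realType) (N m : nat)
    (H : torus R N -> 'rV[R]_N -> R) (Hs : 'I_m -> torus R N -> 'rV[R]_N -> R)
    (B : torus R N -> 'M[R]_m) (u : 'I_m -> torus R N -> R)
    (v w : torus R N -> R) (y : torus R N) :
  (forall i j, continuous (fun x => B x i j)) ->
  (forall x, degenerate_coupling_matrix (B x)) ->
  (forall x, irreducible_matrix (B x)) ->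
  convex_hamiltonian H -> (forall i, Hs i = H) ->
  sys_subsolution Hs B 0 u -> supersolution H 0 v ->
  (forall i x, u i x <= w x) -> (exists i, u i y = w y) ->
  (forall x, w x - v x <= w y - v y) ->
  forall i, u i y = w y.
Proof.
move=> cB Bdeg Birr convH HsE [cu usub] [cv vsup] uw uwy wv.
apply: (irreducible_constant (b := B y)) => // i iw.
apply: (coupling_le_at_max (f := u i) (g := v) (H := H)
    (c := coupling B u i) (d := fun=> 0)) => //.
- exact: coupling_continuous.
- exact: cst_continuous.
- by move=> x p /(usub x i); rewrite HsE.
- by move=> x p /vsup; rewrite addr0.
- by move=> x; rewrite iw; apply: le_trans (wv x); rewrite lerD2r.
Qed.

(** * Aubry sets *)

Lemma le_semidistance (R : realType) (N : nat) (H : torus R N -> 'rV[R]_N -> R)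
    (v : torus R N -> R) (y x : torus R N) :
  subsolution H 0 v -> ((v x - v y)%:E <= semidistance H y x)%E.
Proof. by move=> vsub; apply: ereal_sup_ubound; exists v. Qed.

Lemma semidistance_le_Phi (R : realType) (N m : nat)
    (H : torus R N -> 'rV[R]_N -> R) (Hs : 'I_m -> torus R N -> 'rV[R]_N -> R)
    (B : torus R N -> 'M[R]_m) (i j : 'I_m) (y x : torus R N) :
  (forall x, degenerate_coupling_matrix (B x)) -> (forall i, Hs i = H) ->
  (semidistance H y x <= Phi Hs B i j y x)%E.
Proof.
move=> Bdeg HsE; apply: ge_ereal_sup => _ [v vsub <-].
apply: ereal_sup_ubound; exists (fun=> v) => //.
exact: sys_subsolution_diagonal vsub.
Qed.

Unset Implicit Arguments.

Theorem proposition6p4 (R : realType) (N m : nat)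
    (H : torus R N -> 'rV[R]_N -> R)
    (Hs : 'I_m -> torus R N -> 'rV[R]_N -> R)
    (B : torus R N -> 'M[R]_m) :
  (0 < N)%N -> (0 < m)%N ->
  (forall i j, continuous (fun x => B x i j)) ->
  (forall x, degenerate_coupling_matrix (B x)) ->
  (forall x, irreducible_matrix (B x)) ->
  convex_hamiltonian H ->
  (forall i, Hs i = H) ->
  critical_value H = 0%:E ->
  (forall j : 'I_m, sys_aubry_set Hs B j = aubry_set H) /\
  (forall u : 'I_m -> torus R N -> R, sys_solution Hs B 0 u ->
     exists v : torus R N -> R, solution H 0 v /\ forall i, u i = v).
Proof.
move=> _ m0 cB Bdeg Birr convH HsE _.
have diag u : sys_solution Hs B 0 u ->
    exists v : torus R N -> R, solution H 0 v /\ forall i, u i = v.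
  move=> usol; pose i0 := Ordinal m0.
  have uE i : u i = u i0 := sys_solution_all_equal cB Bdeg Birr convH HsE usol i i0.
  exists (u i0); split=> //.
  apply/(@sys_solution_diagonal _ _ _ _ Hs B _ _ m0 Bdeg HsE).
  by have <- : u = (fun=> u i0) by apply/funext.
split=> // j; apply/seteqP; split=> y [w [wE wsol]].
- have [v [vsol wv]] := diag w wsol.
  have vP x : (v x)%:E = Phi Hs B j j y x by rewrite -wE wv.
  have vy : v y <= 0.
    rewrite -lee_fin vP; apply: ge_ereal_sup => _ [u _ <-].
    by rewrite subrr.
  exists v; split=> // x; apply/eqP; rewrite eq_le; apply/andP; split.
    apply: le_trans (le_semidistance y x vsol.1).
    by rewrite lee_fin lerDl oppr_ge0.
  by rewrite vP; exact: semidistance_le_Phi.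
- exists (fun=> w); split; last exact/(sys_solution_diagonal 0 w m0 Bdeg HsE).
  move=> i x; apply/eqP; rewrite eq_le wE semidistance_le_Phi//=.
  apply: ge_ereal_sup => _ [u usub <-].
  have [s [ssub us su]] := subsolution_max m0 Bdeg HsE usub.
  have sw z : s z - s y <= w z by rewrite -lee_fin wE; exact: le_semidistance.
  have wy : w y = 0.
    apply/eqP; rewrite eq_le; apply/andP; split; last first.
      by have := sw y; rewrite subrr.
    by rewrite -lee_fin wE; apply: ge_ereal_sup => _ [t _ <-]; rewrite subrr.
  have ujy : u j y = s y.
    apply: (components_equal_at_touching_point cB Bdeg Birr convH HsE usub
      wsol.2 us (su y)) => z.
    by rewrite wy subr0 lerBlDr addrC -lerBlDr.
  rewrite -wE lee_fin ujy; apply: le_trans (sw x).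
  by rewrite lerD2r.
Qed.
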